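(* (i) Let $G_1$ and $G_2$ be two cubic graphs, let $u\in V(G_1)$ and $v\in V(G_2)$, and let $G_1(u)*G_2(v)$ be a graph obtained by a star product on $u$ and $v$. If $G_1(u)*G_2(v)$ is PMH, then $G_1$ and $G_2$ are PMH. (ii) The converse of (i) is not true: there exist cubic PMH-graphs $G_1$ and $G_2$, vertices $u\in V(G_1)$ and $v\in V(G_2)$, and a graph $G_1(u)*G_2(v)$ obtained by a star product on $u$ and $v$ which is not PMH.
   Context: Graphs are finite and connected, may have multiple (parallel) edges, and have no loops. A cubic graph is a 3-regular graph. A perfect matching is the edge set of a $1$-regular spanning subgraph, and a Hamiltonian cycle is a connected $2$-regular spanning subgraph. A graph admitting a perfect matching is PMH if each of its perfect matchings is contained in the edge set of a Hamiltonian cycle of the graph. Star product: let $u\in V(G_1)$, $v\in V(G_2)$ be vertices of degree 3, with incident edges $uu_1,uu_2,uu_3$ and $vv_1,vv_2,vv_3$ respectively. A star product on $u$ and $v$, denoted $G_1(u)*G_2(v)$, is the graph $(G_1-u)\cup(G_2-v)\cup\{u_1v_1,u_2v_2,u_3v_3\}$; different orderings of the neighbours may give different graphs, and the notation $G_1(u)*G_2(v)$ stands for any one of them. It is assumed that neither $G_1$ nor $G_2$ is the cubic graph on two vertices (three parallel edges). *)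

(* Defs.v *)
From mathcomp Require Import all_boot.

Set Implicit Arguments.
Unset Strict Implicit.
Unset Printing Implicit Defensive.

(* A finite loopless multigraph.  Parallel edges are distinct elements of
   [edge] with the same set of ends. *)
Record mgraph := MGraph {
  vertex :> finType;
  edge : finType;
  ends : edge -> {set vertex};
  card_ends : forall e, #|ends e| = 2
}.

Section Subgraphs.
Variable G : mgraph.

(* A set of edges F stands for the spanning subgraph (V(G), F). *)
Implicit Types (F M C : {set edge G}) (x y : G).

Definition degree F x : nat := #|[set e in F | x \in ends e]|.

Definition regular k F : Prop := forall x, degree F x = k.

Definition adjacent F : rel G :=
  fun x y => [exists e in F, ends e == [set x; y]].

Definition connected F : Prop := forall x y, connect (adjacent F) x y.

Definition perfect_matching M : Prop := regular 1 M.

Definition hamiltonian_cycle C : Prop := connected C /\ regular 2 C.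

End Subgraphs.

Definition connected_graph (G : mgraph) : Prop := connected [set: edge G].

Definition cubic_graph (G : mgraph) : Prop :=
  connected_graph G /\ regular 3 [set: edge G].

Definition PMH (G : mgraph) : Prop :=
  (exists M : {set edge G}, perfect_matching M) /\
  (forall M : {set edge G}, perfect_matching M ->
     exists C : {set edge G}, hamiltonian_cycle C /\ M \subset C).

(* An ordering of the three edges at a vertex u of degree 3.  Edges are
   ordered rather than neighbours because neighbours may be repeated. *)
Record edge_order (G : mgraph) (u : G) := EdgeOrder {
  nth_edge :> 'I_3 -> edge G;
  nth_edge_inj : injective nth_edge;
  mem_nth_edge : forall e, (e \in codom nth_edge) = (u \in ends e)
}.

Lemma card_sum_set (S T : finType) (A : {pred S}) (B : {pred T}) :
  #|[set z : S + T | match z with inl x => x \in A | inr y => y \in B end]|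
  = #|A| + #|B|.
Proof.
rewrite cardsE -!sum1_card big_sumType /=.
by congr (_ + _); apply: eq_bigl => z.
Qed.

Lemma card_sig_neq (T : finType) (w : T) (A : {set T}) :
  #|[pred x : {x : T | x != w} | val x \in A]| = #|A :\ w|.
Proof.
rewrite -(card_image val_inj); apply: eq_card => x; rewrite !inE.
apply/imageP/andP => [[y yA ->]|[xw xA]]; first by split=> //; exact: (valP y).
by exists (Sub x xw).
Qed.

Section StarProduct.
Variables (G1 G2 : mgraph) (u : G1) (v : G2).
Variables (a : edge_order u) (b : edge_order v).

Definition star_vertex : finType := ({x : G1 | x != u} + {y : G2 | y != v})%type.

Definition star_edge : finType :=
  ({e : edge G1 | u \notin ends e} + {f : edge G2 | v \notin ends f}
   + 'I_3)%type.

(* The edge [inr i] joins the end of [a i] other than u to the end of [b i]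
   other than v. *)
Definition star_ends (e : star_edge) : {set star_vertex} :=
  match e with
  | inl (inl e1) =>
      [set z | if z is inl x then val x \in ends (val e1) else false]
  | inl (inr e2) =>
      [set z | if z is inr y then val y \in ends (val e2) else false]
  | inr i =>
      [set z | match z with
               | inl x => val x \in ends (a i)
               | inr y => val y \in ends (b i)
               end]
  end.

Lemma card_star_ends e : #|star_ends e| = 2.
Proof.
case: e => [[[e ue]|[f vf]]|i].
- have := card_sum_set [pred x : {x : G1 | x != u} | val x \in ends e]
                       (pred0 : {pred {y : G2 | y != v}}).
  rewrite card0 addn0 card_sig_neq (setDidPl _) ?card_ends.
    by apply: etrans; apply: eq_card => -[x|y]; rewrite !inE.
  by rewrite disjoint_sym disjoints1.
- have := card_sum_set (pred0 : {pred {x : G1 | x != u}})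
                       [pred y : {y : G2 | y != v} | val y \in ends f].
  rewrite card0 add0n card_sig_neq (setDidPl _) ?card_ends.
    by apply: etrans; apply: eq_card => -[x|y]; rewrite !inE.
  by rewrite disjoint_sym disjoints1.
- have := card_sum_set [pred x : {x : G1 | x != u} | val x \in ends (a i)]
                       [pred y : {y : G2 | y != v} | val y \in ends (b i)].
  have ua : u \in ends (a i) by rewrite -(mem_nth_edge a) codom_f.
  have vb : v \in ends (b i) by rewrite -(mem_nth_edge b) codom_f.
  have := cardsD1 u (ends (a i)); have := cardsD1 v (ends (b i)).
  rewrite !card_ends ua vb !card_sig_neq !add1n => -[<-] [<-].
  by apply: etrans; apply: eq_card => -[x|y]; rewrite !inE.
Qed.

Definition star_product : mgraph := MGraph card_star_ends.

End StarProduct.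

(* Main.v *)
Require Import Defs.
From mathcomp Require Import all_boot.

Set Implicit Arguments.
Unset Strict Implicit.
Unset Printing Implicit Defensive.

(** Contracting one side of the 3-edge-cut of a star product gives back a
factor.  By parity, a Hamiltonian cycle meets this cut in exactly two edges, so
it contracts to a Hamiltonian cycle, and a perfect matching contained in a
Hamiltonian cycle meets the cut in exactly one edge.  If the star product is
PMH, take a perfect matching M0 and a Hamiltonian cycle C0 containing it: M0,
C0 - M0 and the complement of C0 are three disjoint perfect matchings, so every
edge of the cut lies in one of them.  Hence any perfect matching of a factor
extends to a perfect matching of the star product; a Hamiltonian cycle through
the latter contracts to the one required.

For the converse, K4 is PMH, but in the star product of two copies of K4 (the
prism) the cut itself is a perfect matching, which lies in no Hamiltonian cycle
by the same parity argument. *)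

(** * Degrees and connectivity of spanning subgraphs *)

Section Degrees.
Variable G : mgraph.
Implicit Types (F M C : {set edge G}) (x y : G).

Lemma handshake F : \sum_x degree F x = #|F|.*2.
Proof.
rewrite -muln2 -sum_nat_const.
under eq_bigr => x _ do rewrite /degree -sum1dep_card big_mkcondr /=.
rewrite exchange_big /=; apply: eq_bigr => e _.
by rewrite -big_mkcond /= sum1_card card_ends.
Qed.

Lemma odd_order_cubic : regular 3 [set: edge G] -> ~~ odd #|G|.
Proof.
move=> r3; have := handshake [set: edge G].
under eq_bigr => x _ do rewrite r3.
rewrite sum_nat_const => /(congr1 odd).
by rewrite odd_double oddM andbT => ->.
Qed.

Lemma degreeS F1 F2 x : F1 \subset F2 -> degree F1 x <= degree F2 x.
Proof.
move=> sF; apply/subset_leq_card/subsetP => e.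
by rewrite !inE => /andP[/(subsetP sF)-> ->].
Qed.

Lemma degreeD F1 F2 x :
  F1 \subset F2 -> degree (F2 :\: F1) x = degree F2 x - degree F1 x.
Proof.
move=> sF; rewrite /degree -(cardsID F1 [set e in F2 | x \in ends e]).
rewrite (_ : _ :&: F1 = [set e in F1 | x \in ends e]).
  by rewrite addKn; apply: eq_card => e; rewrite !inE andbA.
apply/setP=> e; rewrite !inE.
by case: (boolP (e \in F1)) => [/(subsetP sF)->|]; rewrite ?andbT ?andbF.
Qed.

Lemma regularD k l F1 F2 : F1 \subset F2 -> regular k F1 -> regular l F2 ->
  regular (l - k) (F2 :\: F1).
Proof. by move=> sF r1 r2 x; rewrite degreeD // r1 r2. Qed.

Lemma degree1_eq F x e e' : degree F x = 1 ->
  e \in F -> x \in ends e -> e' \in F -> x \in ends e' -> e = e'.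
Proof.
move=> /eqP/cards1P[f Ff] eF xe e'F xe'.
have : e \in [set e in F | x \in ends e] by rewrite inE eF.
have : e' \in [set e in F | x \in ends e] by rewrite inE e'F.
by rewrite Ff !inE => /eqP-> /eqP->.
Qed.

Lemma degree1_ex F x : degree F x = 1 -> exists2 e, e \in F & x \in ends e.
Proof.
move=> d1; have : 0 < degree F x by rewrite d1.
by case/card_gt0P=> e; rewrite inE => /andP[]; exists e.
Qed.

Lemma connect_ends F e x y : e \in F -> x \in ends e -> y \in ends e ->
  connect (adjacent F) x y.
Proof.
move=> eF xe ye; have [->|nxy] := eqVneq x y; first exact: connect0.
apply: connect1; apply/existsP; exists e; rewrite eF eq_sym eqEcard.
by rewrite subUset !sub1set xe ye card_ends cards2 nxy.
Qed.

Lemma adjacent_sym F : symmetric (adjacent F).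
Proof. by move=> x y; apply: eq_existsb => e; rewrite setUC. Qed.

Lemma connected_from F x :
  (forall y, connect (adjacent F) x y) -> connected F.
Proof.
move=> cx y z; apply: connect_trans (cx z).
by rewrite (sym_connect_sym (adjacent_sym F)).
Qed.

Lemma connected_degree_gt0 F x y : connected F -> x != y -> 0 < degree F x.
Proof.
move=> cF nxy; have /connectP[[|z p] /=] := cF x y.
  by move=> _ eyx; rewrite eyx eqxx in nxy.
case/andP=> /existsP[e /andP[eF /eqP exz]] _ _.
by apply/card_gt0P; exists e; rewrite inE eF exz set21.
Qed.

Lemma other_end e x : x \in ends e -> exists y, x != y.
Proof.
move=> xe; have := card_ends e; rewrite (cardsD1 x) xe => -[].
by case/eqP/cards1P=> y /setP/(_ y); rewrite !inE eqxx eq_sym => /andP[]; exists y.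
Qed.

Lemma cubic_other_vertex x : regular 3 [set: edge G] -> exists y, x != y.
Proof.
move=> /(_ x) d3; have : 0 < degree [set: edge G] x by rewrite d3.
by case/card_gt0P=> e; rewrite inE => /andP[_ /other_end].
Qed.

End Degrees.

(* [H] is [G] with the vertices of the fibre of [u] identified and the edges
   inside this fibre deleted.  [lift_edge] embeds the edges of [H] in those of
   [G]; the edges at [u] are lifted to the edges leaving the fibre. *)
Record contraction (G H : mgraph) (u : H) := Contraction {
  proj : G -> H;
  lift_edge : edge H -> edge G;
  proj_surj : forall y, exists x, proj x = y;
  lift_edge_inj : injective lift_edge;
  proj_ends : forall x e, x \in ends (lift_edge e) -> proj x \in ends e;
  lift_ends : forall x e, proj x != u -> proj x \in ends e ->
    x \in ends (lift_edge e);
  contracted_ends : forall f, f \notin codom lift_edge ->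
    forall x, x \in ends f -> proj x = u
}.

(** * Matchings and Hamiltonian cycles under contraction to a cubic graph *)

Section Contraction.
Variables (G H : mgraph) (u : H) (c : contraction G u).
Hypotheses (cubG : regular 3 [set: edge G]) (cubH : regular 3 [set: edge H]).
Local Notation p := (proj c).
Local Notation q := (lift_edge c).
Implicit Types (F M C : {set edge G}).

(** A deleted edge has all its ends over [u], so every edge of [F] at [x] is the lift of an edge at
    [p x]. *)
Lemma degree_preim F x :
  p x != u -> degree (q @^-1: F) (p x) = degree F x.
Proof.
move=> pxu; rewrite /degree -(card_imset _ (@lift_edge_inj _ _ _ c)).
apply: eq_card => f; rewrite inE; apply/imsetP/andP => [[e]|[fF xf]].
  by rewrite !inE => /andP[eF xe] ->; split=> //; apply: lift_ends.
have [/codomP[e def_f]|/contracted_ends/(_ x xf) pxE] := boolP (f \in codom q).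
  by exists e => //; rewrite !inE -def_f fF proj_ends // -def_f.
by rewrite pxE eqxx in pxu.
Qed.

(** In the handshake identity of the contracted set, the vertices other than [u] contribute [k]
    each; their number is odd because [H] is cubic, hence of even order. *)
Lemma odd_degree_preim k F :
  regular k F -> odd (degree (q @^-1: F) u) = odd k.
Proof.
move=> rF; have := handshake (q @^-1: F); rewrite (bigD1 u) //=.
rewrite (eq_bigr (fun=> k)) => [|y yu]; last first.
  by have [x px] := proj_surj c y; rewrite -px in yu *; rewrite degree_preim.
rewrite sum_nat_const => /(congr1 odd); rewrite odd_double oddD oddM.
have -> : odd #|[pred y | y != u]|.
  have := odd_order_cubic cubH.
  by rewrite (cardD1 u) /= negbK; congr odd; apply: eq_card => y; rewrite !inE andbT.
by case: (odd _) (odd k) => [] [].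
Qed.

(** A walk in [G] projects to a walk in [H]: each step either follows a lifted edge or stays at
    [u]. *)
Lemma connected_preim F : connected F -> connected (q @^-1: F).
Proof.
move=> cF y z; have [x <-] := proj_surj c y; have [t <-] := proj_surj c z.
case/connectP: (cF x t) => s; elim: s x => [|x' s IHs] x /=; first by move=> _ ->.
case/andP=> /existsP[f /andP[fF /eqP Ef]] ps /(IHs _ ps); apply: connect_trans.
have [xf x'f] : x \in ends f /\ x' \in ends f by rewrite Ef set21 set22.
have [/codomP[e def_f]|/contracted_ends Cf] := boolP (f \in codom q).
  by apply: (@connect_ends _ _ e); rewrite ?inE -?def_f // proj_ends -?def_f.
by rewrite !Cf.
Qed.

(** The degree at [u] is even by parity, positive by connectivity and at most 3. *)
Lemma degree_preim_hamiltonian C :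
  hamiltonian_cycle C -> degree (q @^-1: C) u = 2.
Proof.
case=> cC rC; have := odd_degree_preim rC.
have [y uy] := cubic_other_vertex u cubH.
have := connected_degree_gt0 (connected_preim cC) uy.
have := degreeS u (subsetT (q @^-1: C)); rewrite cubH.
by case: (degree (q @^-1: C) u) => [|[|[|[|]]]].
Qed.

Lemma hamiltonian_preim C :
  hamiltonian_cycle C -> hamiltonian_cycle (q @^-1: C).
Proof.
move=> hC; case: (hC) => cC rC; split; first exact: connected_preim.
move=> y; have [->|] := eqVneq y u; first exact: degree_preim_hamiltonian.
by have [x <-] := proj_surj c y => pxu; rewrite degree_preim.
Qed.

Section PMH.
Hypothesis pmhG : PMH G.

(** The degree at [u] is odd, and at most 2 because a Hamiltonian cycle contains [M]. *)
Lemma degree_preim_matching M :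
  perfect_matching M -> degree (q @^-1: M) u = 1.
Proof.
move=> pM; have := odd_degree_preim pM.
have [C [hC sMC]] := pmhG.2 M pM.
have := degreeS u (preimsetS q sMC); rewrite (degree_preim_hamiltonian hC) //.
by case: (degree (q @^-1: M) u) => [|[|[|]]].
Qed.

Lemma edge_in_perfect_matching (f : edge G) :
  exists2 N : {set edge G}, perfect_matching N & f \in N.
Proof.
have [[M pM] /(_ M pM)[C [[_ rC] sMC]]] := pmhG.
have [fC|fC] := boolP (f \in C); last first.
  by exists (setT :\: C); rewrite ?inE ?fC //; apply: regularD rC cubG; apply: subsetT.
have [fM|fM] := boolP (f \in M); first by exists M.
by exists (C :\: M); rewrite ?inE ?fC ?fM //; apply: regularD pM rC.
Qed.

(** [M1] is glued to a perfect matching [N] of [G] that uses the same cut edge: lifted edges are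
    taken from [M1], edges inside the fibre of [u] from [N]. *)
Lemma extend_perfect_matching (M1 : {set edge H}) : perfect_matching M1 ->
  exists2 M : {set edge G}, perfect_matching M & q @^-1: M = M1.
Proof.
move=> pM1; have [e0 e0M ue0] := degree1_ex (pM1 u).
have [N pN e0N] := edge_in_perfect_matching (q e0).
have dN := degree_preim_matching pN.
pose M := q @: M1 :|: (N :\: [set f in codom q]).
have qM : q @^-1: M = M1.
  apply/setP=> e; rewrite !inE codom_f orbF.
  by rewrite mem_imset //; apply: lift_edge_inj.
exists M => // x; have [pxu|pxu] := eqVneq (p x) u; last first.
  by rewrite -degree_preim // qM pM1.
rewrite -(pN x); apply: eq_card => f; rewrite !inE.
have [xf|_] := boolP (x \in ends f); rewrite ?andbF // !andbT.
have [/codomP[e def_f]|fq] /= := boolP (f \in codom q); last first.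
  by case: imsetP => // -[e _ fE]; rewrite fE codom_f in fq.
have ue : u \in ends e by rewrite -pxu proj_ends -?def_f.
rewrite orbF def_f mem_imset; last exact: lift_edge_inj.
(* For an edge [e] at [u], membership in [M1] and membership of its lift in [N] both amount to
   [e = e0], so over [u] the degrees in [M] and [N] agree. *)
apply/idP/idP => [eM|eN].
  by rewrite (degree1_eq (pM1 u) eM ue e0M ue0).
by rewrite (degree1_eq dN (e := e) (e' := e0)) ?inE.
Qed.

Lemma PMH_contraction : PMH H.
Proof.
have [[M pM] _] := pmhG; split.
  exists (q @^-1: M) => y; have [->|] := eqVneq y u.
    exact: degree_preim_matching.
  by have [x <-] := proj_surj c y => pxu; rewrite degree_preim.
move=> M1 /extend_perfect_matching[M' pM' <-].
have [C [hC sMC]] := pmhG.2 M' pM'.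
by exists (q @^-1: C); split; [apply: hamiltonian_preim | apply: preimsetS].
Qed.

End PMH.
End Contraction.

(** * Separating the three edges at a vertex from the others *)

Section EdgeOrder.
Variables (G : mgraph) (u : G) (a : edge_order u).

Lemma nth_edge_ends i : u \in ends (a i).
Proof. by rewrite -(mem_nth_edge a) codom_f. Qed.

(** The source type is the share of one factor in [star_edge], cut edges included; inverting this
    bijection tells how an edge of the factor sits in the star product. *)
Definition unsplit_edge (s : {e : edge G | u \notin ends e} + 'I_3) : edge G :=
  match s with inl e => val e | inr i => a i end.

Lemma unsplit_edge_inj : injective unsplit_edge.
Proof.
move=> [e|i] [e'|i'] /= => [/val_inj->|ee|ee|/nth_edge_inj->] //.
  by have := valP e; rewrite /= ee nth_edge_ends.
by have := valP e'; rewrite /= -ee nth_edge_ends.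
Qed.

Lemma unsplit_edge_codom e : e \in codom unsplit_edge.
Proof.
have [|ue] := boolP (u \in ends e).
  by rewrite -(mem_nth_edge a) => /codomP[i ->]; apply: (codom_f _ (inr i)).
by apply: (codom_f unsplit_edge (inl (Sub e ue))).
Qed.

Definition split_edge e := iinv (unsplit_edge_codom e).

Lemma split_edgeK : cancel split_edge unsplit_edge.
Proof. by move=> e; apply: f_iinv. Qed.

Lemma unsplit_edgeK : cancel unsplit_edge split_edge.
Proof. by move=> s; apply: unsplit_edge_inj; rewrite split_edgeK. Qed.

End EdgeOrder.

(** * The two contractions of a star product *)

Section Star.
Variables (G1 G2 : mgraph) (u : G1) (v : G2).
Variables (a : edge_order u) (b : edge_order v).
Local Notation S := (star_product a b).

Definition star_proj1 (z : S) : G1 := if z is inl x then val x else u.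
Definition star_proj2 (z : S) : G2 := if z is inr y then val y else v.

Definition star_lift1 (e : edge G1) : edge S :=
  match split_edge a e with inl e1 => inl (inl e1) | inr i => inr i end.
Definition star_lift2 (e : edge G2) : edge S :=
  match split_edge b e with inl e2 => inl (inr e2) | inr i => inr i end.

Lemma vertex_other (G : mgraph) (w : G) (o : edge_order w) : exists y, w != y.
Proof. exact: (@other_end G (o ord0) w (nth_edge_ends o ord0)). Qed.

Definition star_contraction1 : contraction S u.
Proof.
apply: (@Contraction _ _ _ star_proj1 star_lift1).
- move=> x; have [->|xu] := eqVneq x u; last by exists (inl (Sub x xu)).
  (* The fibre of [u] is the whole side of [G2], so a vertex other than [v] is needed there. *)
  have [y vy] := vertex_other b.
  by rewrite eq_sym in vy; exists (inr (Sub y vy)).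
(* [a ord0] is a dummy value, taken on edges of the other side, which are not lifts. *)
- apply: (can_inj (g := fun f : edge S => match f with
    inl (inl e1) => val e1 | inr i => a i | _ => a ord0 end)) => e.
  by rewrite -{2}(split_edgeK a e) /star_lift1; case: (split_edge a e).
- move=> z e; rewrite -{2}(split_edgeK a e) /star_lift1.
  by case: (split_edge a e) z => [e1|i] [x|y]; rewrite /= !inE // nth_edge_ends.
- move=> z e; rewrite -{1}(split_edgeK a e) /star_lift1.
  by case: (split_edge a e) z => [e1|i] [x|y]; rewrite /= ?eqxx ?inE.
- move=> [[e1|e2]|i].
  + by case/codomP; exists (val e1); rewrite /star_lift1 (unsplit_edgeK a (inl e1)).
  + by move=> _ [x|y]; rewrite /= ?inE.
  + by case/codomP; exists (a i); rewrite /star_lift1 (unsplit_edgeK a (inr i)).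
Defined.

Definition star_contraction2 : contraction S v.
Proof.
apply: (@Contraction _ _ _ star_proj2 star_lift2).
- move=> y; have [->|yv] := eqVneq y v; last by exists (inr (Sub y yv)).
  have [x ux] := vertex_other a.
  by rewrite eq_sym in ux; exists (inl (Sub x ux)).
- apply: (can_inj (g := fun f : edge S => match f with
    inl (inr e2) => val e2 | inr i => b i | _ => b ord0 end)) => e.
  by rewrite -{2}(split_edgeK b e) /star_lift2; case: (split_edge b e).
- move=> z e; rewrite -{2}(split_edgeK b e) /star_lift2.
  by case: (split_edge b e) z => [e2|i] [x|y]; rewrite /= !inE // nth_edge_ends.
- move=> z e; rewrite -{1}(split_edgeK b e) /star_lift2.
  by case: (split_edge b e) z => [e2|i] [x|y]; rewrite /= ?eqxx ?inE.
- move=> [[e1|e2]|i].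
  + by move=> _ [x|y]; rewrite /= ?inE.
  + by case/codomP; exists (val e2); rewrite /star_lift2 (unsplit_edgeK b (inl e2)).
  + by case/codomP; exists (b i); rewrite /star_lift2 (unsplit_edgeK b (inr i)).
Defined.

(** Each vertex keeps its degree in the contraction onto its own factor. *)
Lemma star_regular k : regular k [set: edge G1] -> regular k [set: edge G2] ->
  regular k [set: edge S].
Proof.
move=> r1 r2 [x|y].
  by rewrite -(degree_preim (c := star_contraction1)) ?preimsetT ?r1 //; apply: (valP x).
by rewrite -(degree_preim (c := star_contraction2)) ?preimsetT ?r2 //; apply: (valP y).
Qed.

(** A Hamiltonian cycle containing the whole cut would contract to degree 3 at [u], instead of 2. *)
Lemma star_cut_not_hamiltonian C : regular 3 [set: edge G1] ->
  hamiltonian_cycle C ->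
  ~~ ([set e : edge S | if e is inr _ then true else false] \subset C).
Proof.
move=> r1 hC; apply/negP=> sC.
have := degree_preim_hamiltonian star_contraction1 r1 hC.
suff -> : degree (lift_edge star_contraction1 @^-1: C) u = 3 by [].
rewrite -(r1 u); apply: eq_card => e; rewrite !inE andTb.
have [|_] := boolP (u \in ends e); rewrite ?andbF // andbT.
rewrite -(mem_nth_edge a) => /codomP[i ->].
by rewrite (subsetP sC) // inE /= /star_lift1 (unsplit_edgeK a (inr i)).
Qed.

End Star.

(** * The complete graph on four vertices and the prism *)

Section K4.
Implicit Types (i j k : 'I_3) (x : option 'I_3).

(* The centre [None] and the triangle [Some i].  The edges [(true, i)] and
   [(false, i)] are the spoke to [Some i] and the opposite edge, so that the
   second components form a proper 3-edge-colouring. *)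
Definition K4_ends (e : bool * 'I_3) : {set option 'I_3} :=
  [set x | (x \in [set None; Some e.2]) == e.1].

Lemma card_K4_ends e : #|K4_ends e| = 2.
Proof.
case: e => -[] i; rewrite /K4_ends /=.
  by apply: etrans (cards2 None (Some i)); apply: eq_card => x; rewrite !inE eqb_id.
have := cardsC [set None; Some i]; rewrite cards2 card_option card_ord => -[].
by apply: etrans; apply: eq_card => x; rewrite !inE eqbF_neg.
Qed.

Definition K4 : mgraph := MGraph card_K4_ends.

(** Each vertex meets exactly one edge of each colour [i]: the spoke if it is [None] or [Some i],
    the opposite edge otherwise. *)
Lemma regular_colors (K : {set 'I_3}) :
  regular #|K| [set e : edge K4 | e.2 \in K].
Proof.
move=> x; have inj : injective (fun i => (x \in [set None; Some i], i)).
  by move=> i j [].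
rewrite /degree -(card_imset _ inj); apply: eq_card => -[t i].
rewrite !inE /=; apply/andP/imsetP => [[iK /eqP<-]|[j jK [-> ->]]].
  by exists i; rewrite ?inE.
by rewrite !inE eqxx.
Qed.

Lemma third_color i j : exists2 k, k != i & k != j.
Proof.
have : 0 < #|~: [set i; j]|.
  have := cardsC [set i; j]; rewrite card_ord cards2.
  by case: #|~: _| => //; case: (i != j).
by case/card_gt0P=> k; rewrite !inE negb_or => /andP[]; exists k.
Qed.

Lemma connected_colors j : connected [set e : edge K4 | e.2 \in [set~ j]].
Proof.
have spoke i : i != j ->
    connect (adjacent [set e : edge K4 | e.2 \in [set~ j]]) None (Some i).
  by move=> ij; apply: (@connect_ends K4 _ (true, i)); rewrite !inE ?eqxx ?orbT.
apply: (@connected_from K4 _ None) => -[i|]; last exact: connect0.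
have [->|/spoke//] := eqVneq i j.
(* The spoke to [Some j] is missing; this vertex is reached through [Some k] by the triangle edge of
   the third colour [l]. *)
have [k kj _] := third_color j j; have [l lj lk] := third_color j k.
apply: connect_trans (spoke k kj) _.
apply: (@connect_ends K4 _ (false, l)); rewrite !inE //=.
  by rewrite (inj_eq Some_inj) (eq_sym k) (negPf lk).
by rewrite (inj_eq Some_inj) (eq_sym j) (negPf lj).
Qed.

Lemma hamiltonian_colors j :
  hamiltonian_cycle [set e : edge K4 | e.2 \in [set~ j]].
Proof.
split; first exact: connected_colors.
by have := @regular_colors [set~ j]; rewrite cardsC1 card_ord.
Qed.

Lemma K4_cubic : cubic_graph K4.
Proof.
split.
  apply: (@connected_from K4 _ None) => y.
  apply: connect_sub (connected_colors ord0 None y) => x z.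
  case/existsP=> e /andP[_ ez]; apply: connect1.
  by apply/existsP; exists e; rewrite inE.
move=> x; have := regular_colors [set: 'I_3] x; rewrite cardsT card_ord.
by apply: etrans; apply: eq_card => e; rewrite !inE.
Qed.

Lemma K4_PMH : PMH K4.
Proof.
split.
  exists [set e : edge K4 | e.2 \in [set ord0]].
  by have := @regular_colors [set ord0]; rewrite cards1.
move=> M pM; have [[[] i] iM //] := degree1_ex (pM None); rewrite !inE //= => _.
(* With [(true, i)] the spoke in [M], no edge of [M] has a colour [j] other than [i]: a spoke would
   share the centre with it, a triangle edge would share [Some i]. Hence [M] lies in the 4-cycle of
   the two colours other than [j]. *)
have [j ji _] := third_color i i.
exists [set e : edge K4 | e.2 \in [set~ j]]; split; first exact: hamiltonian_colors.
apply/subsetP=> -[t k] kM; rewrite !inE /=; apply: contraNneq ji => kj.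
rewrite {k}kj in kM; apply/eqP.
case: t kM => jM.
  suff [->] : (true, j) = (true, i) :> edge K4 by [].
  by apply: degree1_eq (pM None) jM _ iM _; rewrite !inE.
have [//|ji] := eqVneq j i.
suff [] : (false, j) = (true, i) :> edge K4 by [].
apply: degree1_eq (pM (Some i)) jM _ iM _; rewrite !inE /= ?eqxx //.
by rewrite (inj_eq Some_inj) (eq_sym i) (negPf ji).
Qed.

Lemma spoke_inj : injective (fun i => (true, i) : edge K4).
Proof. by move=> i j []. Qed.

Lemma mem_spoke (e : edge K4) :
  (e \in codom (fun i => (true, i) : edge K4)) = ((None : K4) \in ends e).
Proof.
case: e => t i; rewrite !inE /=; apply/codomP/eqP => [[j [-> _]] //|<-].
by exists i.
Qed.

Definition spokes : edge_order (None : K4) := EdgeOrder spoke_inj mem_spoke.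

Definition prism : mgraph := star_product spokes spokes.

Definition prism_rungs : {set edge prism} :=
  [set e | if e is inr _ then true else false].

Lemma prism_rungs_matching : perfect_matching prism_rungs.
Proof.
move=> z; apply/eqP/cards1P.
case: z => -[[i|] zN] //; exists (inr i); apply/setP=> -[[e|e]|j] //=;
  by rewrite !inE //= eqb_id eq_sym (inj_eq Some_inj).
Qed.

Lemma prism_connected : connected_graph prism.
Proof.
pose w i : {x : K4 | x != None} := Sub (Some i) isT.
have side i : connect (adjacent [set: edge prism]) (inl (w ord0)) (inl (w i)).
  (* The triangle edge opposite to [Some k] contains both [Some ord0] and [Some i], even when they
     coincide. *)
  have [k k0 ki] := third_color ord0 i.
  have Nk : (None : K4) \notin ends ((false, k) : edge K4) by rewrite !inE.
  apply: (@connect_ends prism _ (inl (inl (Sub ((false, k) : edge K4) Nk))));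
    by rewrite ?inE //= (inj_eq Some_inj) eqbF_neg eq_sym.
apply: (@connected_from prism _ (inl (w ord0))) => -[] [[i|] zN] //.
  by rewrite (bool_irrelevance zN isT); apply: side.
(* The second triangle is reached from the first along rung [i]. *)
rewrite (bool_irrelevance zN isT); apply: connect_trans (side i) _.
by apply: (@connect_ends prism _ (inr i)); rewrite ?inE /= ?inE ?eqxx ?orbT.
Qed.

End K4.

Theorem proposition3p1 :
  (forall (G1 G2 : mgraph) (u : G1) (v : G2)
          (a : edge_order u) (b : edge_order v),
     cubic_graph G1 -> cubic_graph G2 ->
     #|G1| != 2 -> #|G2| != 2 ->
     PMH (star_product a b) ->
     PMH G1 /\ PMH G2)
  /\
  (exists (G1 G2 : mgraph) (u : G1) (v : G2)
          (a : edge_order u) (b : edge_order v),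
     (cubic_graph G1 /\ #|G1| != 2 /\ PMH G1) /\
     (cubic_graph G2 /\ #|G2| != 2 /\ PMH G2) /\
     connected_graph (star_product a b) /\
     ~ PMH (star_product a b)).
Proof.
split=> [G1 G2 u v a b [_ r1] [_ r2] _ _ pmhS|].
  have rS := star_regular (a := a) (b := b) r1 r2.
  split; first exact: PMH_contraction (star_contraction1 a b) rS r1 pmhS.
  exact: PMH_contraction (star_contraction2 a b) rS r2 pmhS.
have K4_order : #|K4| != 2 by rewrite card_option card_ord.
have K4_ok : cubic_graph K4 /\ #|K4| != 2 /\ PMH K4.
  by split; [apply: K4_cubic | split=> //; apply: K4_PMH].
exists K4, K4, None, None, spokes, spokes; do 2![split=> //].
split; first exact: prism_connected.
case=> _ /(_ _ prism_rungs_matching)[C [hC]].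
exact/negP/(star_cut_not_hamiltonian K4_cubic.2 hC).
Qed.
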